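(* There exist absolute constants $c>0$ and $d_0$ such that for all $d\ge d_0$, all $\kappa$ with $10\le \kappa\le d^4$, and every step size $h>0$, there is a Gaussian density $\pi\propto e^{-f}$ on $\mathbb{R}^d$, with $f$ a quadratic satisfying $I\preceq \nabla^2 f\preceq \kappa I$, such that the relaxation time of the MALA Markov chain with step size $h$ and stationary distribution $\pi$ is at least $c\,\kappa\sqrt d/\sqrt{\log d}$.
   Context: For $f:\mathbb{R}^d\to\mathbb{R}$ differentiable with $\int e^{-f}<\infty$, let $\pi$ denote the probability measure with density proportional to $e^{-f}$. The MALA (Metropolis-adjusted Langevin algorithm) Markov chain with step size $h>0$ is defined as follows: from the current point $x$, propose $y=x-h\nabla f(x)+\sqrt{2h}\,g$ with $g\sim\mathcal N(0,I_d)$; move to $y$ with probability $\min\{1,\exp(f(x)-f(y)+\frac{1}{4h}(\|y-x+h\nabla f(x)\|_2^2-\|x-y+h\nabla f(y)\|_2^2))\}$, and otherwise stay at $x$. This chain is reversible with stationary distribution $\pi$. For a Markov kernel $\{\mathcal T_x\}$ reversible with respect to $\pi$, the Dirichlet form is $\mathcal E(\phi,\phi)=\frac12\iint(\phi(x)-\phi(y))^2\,\mathcal T_x(dy)\,\pi(dx)$, the spectral gap is $\lambda=\inf\{\mathcal E(\phi,\phi)/\mathrm{Var}_\pi(\phi)\}$ over non-constant $\phi\in L^2(\pi)$, and the relaxation time is $1/\lambda$ (infinite if $\lambda=0$). *)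

(* Defs.v *)
From HB Require Import structures.
From mathcomp Require Import all_boot all_order all_algebra.
From mathcomp Require Import all_classical all_reals all_analysis.
From mathcomp Require Import Rstruct Rstruct_topology.
From Stdlib Require Import Rdefinitions.

Set Implicit Arguments.
Unset Strict Implicit.
Unset Printing Implicit Defensive.
Import Order.TTheory GRing.Theory Num.Theory.
Import numFieldNormedType.Exports.
Local Open Scope classical_set_scope.
Local Open Scope ring_scope.

Notation R := Rdefinitions.R.

(* Lebesgue integral over R^d of a [0,+oo]-valued function, written as the
   iterated one-dimensional Lebesgue integral (Tonelli). *)
Fixpoint leb_int (n : nat) : ('rV[R]_n -> \bar R) -> \bar R :=
  match n return ('rV[R]_n -> \bar R) -> \bar R with
  | 0 => fun F => F 0
  | n'.+1 => fun F =>
      (\int[@lebesgue_measure R]_x leb_int (fun v : 'rV[R]_n' => F (row_mx (\row_(_ < 1) x) v)))%E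
  end.

(* identification of d.-tuples (with the product Borel sigma-algebra) with R^d *)
Definition row_of_tuple (d : nat) (t : d.-tuple (measurableTypeR R)) : 'rV[R]_d := \row_i tnth t i.

Definition sqnorm (d : nat) (v : 'rV[R]_d) : R := \sum_i (v 0 i) ^+ 2.

Definition qform (d : nat) (A : 'M[R]_d) (v : 'rV[R]_d) : R := (v *m A *m v^T) 0 0.

Definition grad (d : nat) (f : 'rV[R]_d -> R) (x : 'rV[R]_d) : 'rV[R]_d :=
  \row_i (derive (f : 'rV[R]_d -> R^o) x (delta_mx 0 i : 'rV[R]_d)).

Section MALA.
Variables (d : nat) (f : 'rV[R]_d -> R) (h : R).

Definition norm_const : R := fine (leb_int (fun x => (expR (- f x))%:E)).
Definition pi_dens (x : 'rV[R]_d) : R := expR (- f x) / norm_const.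

(* MALA proposal density q(x, y): y = x - h grad f(x) + sqrt(2h) g *)
Definition mala_prop (x y : 'rV[R]_d) : R :=
  (4 * pi * h) `^ (- (d%:R / 2)) * expR (- (sqnorm (y - x + h *: grad f x) / (4 * h))).

Definition mala_acc (x y : 'rV[R]_d) : R :=
  Num.min 1 (expR (f x - f y + (sqnorm (y - x + h *: grad f x)
                                - sqnorm (x - y + h *: grad f y)) / (4 * h))).

(* integral of a nonnegative G against the MALA kernel T_x:
   T_x(dy) = acc(x,y) q(x,y) dy + (1 - \int acc(x,y') q(x,y') dy') delta_x(dy) *)
Definition mala_kint (x : 'rV[R]_d) (G : 'rV[R]_d -> \bar R) : \bar R :=
  (leb_int (fun y => (mala_acc x y * mala_prop x y)%:E * G y)
   + (1 - leb_int (fun y => (mala_acc x y * mala_prop x y)%:E)) * G x)%E.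

Definition dirichlet (phi : 'rV[R]_d -> R) : \bar R :=
  ((1/2)%:E * leb_int (fun x => (pi_dens x)%:E *
                          mala_kint x (fun y => ((phi x - phi y) ^+ 2)%:E)))%E.

Definition pi_mean (phi : 'rV[R]_d -> R) : R :=
  fine (leb_int (fun x => (pi_dens x * phi x)%:E)).

Definition pi_var (phi : 'rV[R]_d -> R) : R :=
  fine (leb_int (fun x => (pi_dens x * (phi x - pi_mean phi) ^+ 2)%:E)).

Definition L2_nonconst (phi : 'rV[R]_d -> R) : Prop :=
  measurable_fun setT (fun t : d.-tuple (measurableTypeR R) => (phi (row_of_tuple t) : measurableTypeR R)) /\
  (leb_int (fun x => (pi_dens x * phi x ^+ 2)%:E) < +oo)%E /\
  0 < pi_var phi.

Definition spectral_gap : \bar R :=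
  ereal_inf [set (dirichlet phi * ((pi_var phi)^-1)%:E)%E | phi in L2_nonconst].

Definition relaxation_time : \bar R :=
  if spectral_gap == 0%E then +oo%E else ((fine spectral_gap)^-1)%:E.

End MALA.

(* Main.v *)
Require Import Defs.
From HB Require Import structures.
From mathcomp Require Import all_boot all_order all_algebra.
From mathcomp Require Import all_classical all_reals all_analysis.
From mathcomp Require Import Rstruct Rstruct_topology.
From mathcomp Require Import exp measurable_realfun ring lra.

Set Implicit Arguments.
Unset Strict Implicit.
Unset Printing Implicit Defensive.
Import Order.TTheory GRing.Theory Num.Theory.
Import numFieldNormedType.Exports.
Local Open Scope ring_scope.

(** The target is chosen after the step size [h], among the isotropic quadratics
    [k/2 |x|^2] with [k = 1] or [k = kappa].  If [h <= 5 sqrt(ln d) / (kappa sqrt d)],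
    take [k = 1] and test the Dirichlet form on the coordinate [x_0]: one step moves
    it by [O(sqrt h)] in mean square, so the spectral gap is [O(h)].  If [h] is
    larger, take [k = kappa] and test on the indicator of a tiny box at the origin.
    With [u = h kappa], the log acceptance ratio is [(h kappa^2 / 4) (|x|^2 - |y|^2)], so
    a move out of the origin is accepted with probability [(1 + u^2)^(-d/2)], which is
    at most [d^-5] and bounds the gap up to a constant. *)

(** * One-dimensional Lebesgue integrals of nonnegative functions *)

Section LineIntegral.
Variable K : realType.
Local Notation mu := (@lebesgue_measure K).
Implicit Types (F G : K -> \bar K) (f g : K -> K) (a b c : K).

(* No measurability is needed: the integral of a nonnegative function is a supremum
   over the simple functions below it. *)
Lemma le_integral_nonmeas F G :
  (forall x, 0 <= F x)%E -> (forall x, F x <= G x)%E ->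
  (\int[mu]_x F x <= \int[mu]_x G x)%E.
Proof.
move=> F0 FG; rewrite !ge0_integralTE//; last first.
  by move=> x; exact: le_trans (FG x).
apply: ereal_sup_le => _ [g gF <-]; exists g => // x.
exact: le_trans (FG x).
Qed.

(** Bundling measurability and sign with a finite real value lets integrals be combined without
    repeated side conditions. *)
Definition has_lint g c : Prop :=
  [/\ measurable_fun setT g, (forall x, 0 <= g x) &
      (\int[mu]_x (g x)%:E = c%:E)%E].

Lemma has_lint_ge0 g c : has_lint g c -> 0 <= c.
Proof.
move=> [_ g0 gc]; rewrite -lee_fin -gc.
by apply: integral_ge0 => x _; rewrite lee_fin.
Qed.

Lemma has_lintZ g c a : 0 <= a -> has_lint g c ->
  has_lint (fun x => a * g x) (a * c).
Proof.
move=> a0 [mg g0 gc]; split.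
- exact: measurable_funM.
- by move=> x; rewrite mulr_ge0.
- under eq_integral do rewrite EFinM.
  rewrite ge0_integralZl_EFin ?gc//; last exact/measurable_EFinP.
  by move=> x _; rewrite lee_fin.
Qed.

Lemma has_lintD f g c c' : has_lint f c -> has_lint g c' ->
  has_lint (fun x => f x + g x) (c + c').
Proof.
move=> [mf f0 fc] [mg g0 gc]; split.
- exact: measurable_funD.
- by move=> x; rewrite addr_ge0.
- under eq_integral do rewrite EFinD.
  by rewrite ge0_integralD ?fc ?gc//; try (by move=> x _; rewrite lee_fin);
    exact/measurable_EFinP.
Qed.

(** Domination yields a finite value even when no closed form is at hand; this is how truncated
    Gaussians and second moments get one. *)
Lemma le_has_lint f g c : measurable_fun setT f -> (forall x, 0 <= f x <= g x) ->
  has_lint g c -> exists2 b, has_lint f b & 0 <= b <= c.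
Proof.
move=> mf fg [_ _ gc].
have f0 x : 0 <= f x by case/andP: (fg x).
have Ic : (\int[mu]_x (f x)%:E <= c%:E)%E.
  rewrite -gc; apply: le_integral_nonmeas => x; rewrite lee_fin//.
  by case/andP: (fg x).
have I0 : (0 <= \int[mu]_x (f x)%:E)%E.
  by apply: integral_ge0 => x _; rewrite lee_fin.
have If : (\int[mu]_x (f x)%:E)%E \is a fin_num.
  by rewrite ge0_fin_numE// (le_lt_trans Ic)// ltry.
exists (fine (\int[mu]_x (f x)%:E)%E); first by split; rewrite ?fineK.
by rewrite -!lee_fin fineK// I0.
Qed.

Lemma has_lint_le f g c c' : has_lint f c -> has_lint g c' ->
  (forall x, f x <= g x) -> c <= c'.
Proof.
move=> [_ f0 fc] [_ _ gc] fg; rewrite -lee_fin -fc -gc.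
by apply: le_integral_nonmeas => x; rewrite lee_fin.
Qed.

Lemma has_lint_indic a b : a <= b ->
  has_lint (\1_`[a, b]%classic) (b - a).
Proof.
move=> ab; split => //.
  by rewrite integral_indic//= setIT lebesgue_measure_itv/= lte_fin lt_neqAle ab
     andbT; case: eqP => [->|_]; rewrite /= ?subrr ?EFinB.
Qed.

End LineIntegral.

(** * Iterated integrals over [R^d] of product functions *)

Lemma leb_int_ge0 n (F : 'rV[R]_n -> \bar R) :
  (forall v, 0 <= F v)%E -> (0 <= leb_int F)%E.
Proof.
elim: n F => [|n IH] F F0 /=; first exact: F0.
by apply: integral_ge0 => x _; apply: IH.
Qed.

Lemma le_leb_int n (F G : 'rV[R]_n -> \bar R) :
  (forall v, 0 <= F v)%E -> (forall v, F v <= G v)%E ->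
  (leb_int F <= leb_int G)%E.
Proof.
elim: n F G => [|n IH] F G F0 FG /=; first exact: FG.
apply: le_integral_nonmeas => x; first exact: leb_int_ge0.
exact: IH.
Qed.

Lemma eq_leb_int n (F G : 'rV[R]_n -> \bar R) :
  (forall v, F v = G v) -> leb_int F = leb_int G.
Proof. by move=> /funext ->. Qed.

Lemma row_mxE0 n x (v : 'rV[R]_n) :
  (row_mx (\row_(_ < 1) x) v : 'rV[R]_n.+1) 0 ord0 = x.
Proof.
have <- : lshift n (ord0 : 'I_1) = ord0 :> 'I_n.+1 by exact: val_inj.
by apply: etrans (row_mxEl _ _ _ _) _; rewrite mxE.
Qed.

Lemma row_mxES n x (v : 'rV[R]_n) i :
  (row_mx (\row_(_ < 1) x) v : 'rV[R]_n.+1) 0 (lift ord0 i) = v 0 i.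
Proof.
have -> : lift ord0 i = rshift 1 i by exact: val_inj.
exact: row_mxEr.
Qed.

(** Induction on the dimension: at a fixed first coordinate the integrand has the same shape, with
    its first factors absorbed into the weights [a] and [b]. Treating two products together avoids
    proving additivity of [leb_int] for general functions. *)
Lemma leb_int_prod2 n (f g : 'I_n -> R -> R) (cf cg : 'I_n -> R) (a b : R) :
  (forall i, has_lint (f i) (cf i)) -> (forall i, has_lint (g i) (cg i)) ->
  0 <= a -> 0 <= b ->
  leb_int (fun v : 'rV[R]_n =>
    (a * \prod_i f i (v 0 i) + b * \prod_i g i (v 0 i))%:E) =
  (a * \prod_i cf i + b * \prod_i cg i)%:E.
Proof.
elim: n f g cf cg a b => [|n IH] f g cf cg a b If Ig a0 b0 /=.
  by rewrite !big_ord0.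
have prod_ge0 (c : 'I_n.+1 -> R) h : (forall i, has_lint (h i) (c i)) ->
    0 <= \prod_i c (lift ord0 i).
  by move=> H; apply: prodr_ge0 => i _; exact: has_lint_ge0 (H _).
have IF := has_lintZ (mulr_ge0 a0 (prod_ge0 _ _ If)) (If ord0).
have IG := has_lintZ (mulr_ge0 b0 (prod_ge0 _ _ Ig)) (Ig ord0).
have [_ _ E] := has_lintD IF IG.
rewrite !big_ord_recl [cf _ * _]mulrC [cg _ * _]mulrC !mulrA -E; apply: eq_integral => x _.
pose f0x := a * f ord0 x; pose g0x := b * g ord0 x.
transitivity (leb_int (fun v : 'rV[R]_n =>
    (f0x * \prod_i f (lift ord0 i) (v 0 i) +
     g0x * \prod_i g (lift ord0 i) (v 0 i))%:E)).
  apply: eq_leb_int => v; rewrite !big_ord_recl !row_mxE0.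
  have tail (h : 'I_n.+1 -> R -> R) :
      \prod_(i < n) h (lift ord0 i)
        ((row_mx (\row_(_ < 1) x) v : 'rV[R]_n.+1) 0 (lift ord0 i)) =
      \prod_(i < n) h (lift ord0 i) (v 0 i).
    by apply: eq_bigr => i _; rewrite row_mxES.
  by rewrite !tail !mulrA.
have f0x0 : 0 <= f0x by have [_ ? _] := If ord0; rewrite mulr_ge0.
have g0x0 : 0 <= g0x by have [_ ? _] := Ig ord0; rewrite mulr_ge0.
rewrite (IH _ _ _ _ _ _ (fun i => If (lift ord0 i)) (fun i => Ig (lift ord0 i)))//.
by rewrite /f0x /g0x; congr (_%:E); ring.
Qed.

Lemma leb_int_prod n (f : 'I_n -> R -> R) (c : 'I_n -> R) (a : R) :
  (forall i, has_lint (f i) (c i)) -> 0 <= a ->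
  leb_int (fun v : 'rV[R]_n => (a * \prod_i f i (v 0 i))%:E) =
  (a * \prod_i c i)%:E.
Proof.
move=> If a0; have := leb_int_prod2 If If a0 (lexx 0).
by rewrite mul0r addr0 => <-; apply: eq_leb_int => v; rewrite mul0r addr0.
Qed.

(** * Gaussian integrals and the gradient of an isotropic quadratic *)

Definition gauss_mass (a : R) : R := Num.sqrt (pi / a).

Lemma gauss_mass_gt0 a : 0 < a -> 0 < gauss_mass a.
Proof. by move=> a0; rewrite sqrtr_gt0 divr_gt0 ?pi_gt0. Qed.

(** The integrand is [gauss_mass a] times the normal density of mean [m] and variance [1 / (2a)],
    whose total mass is 1. *)
Lemma has_lint_gauss a m : 0 < a ->
  has_lint (fun x : R => expR (- (a * (x - m) ^+ 2))) (gauss_mass a).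
Proof.
move=> a0; pose s := Num.sqrt ((2 * a)^-1) : R.
have s2 : s ^+ 2 = (2 * a)^-1 by rewrite sqr_sqrtr// invr_ge0 mulr_ge0// ltW.
have s0 : s != 0 by rewrite gt_eqF// sqrtr_gt0 invr_gt0 mulr_gt0.
have a_neq0 : a != 0 by rewrite gt_eqF.
have E x : normal_pdf m s x = (gauss_mass a)^-1 * expR (- (a * (x - m) ^+ 2)).
  rewrite normal_pdfE// /normal_peak /normal_fun s2; congr (_^-1 * expR _).
    by congr Num.sqrt; rewrite -mulr_natr; field.
  by rewrite -mulr_natr; field.
have N : has_lint (fun x : R => normal_pdf m s x) 1.
  split; [exact: measurable_normal_pdf|exact: normal_pdf_ge0|].
  exact: integral_normal_pdf.
have G0 := gauss_mass_gt0 a0.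
have := has_lintZ (ltW G0) N; rewrite mulr1; congr has_lint.
by apply/funext => x; rewrite E mulrA divff ?mul1r// gt_eqF.
Qed.

Lemma cvg_affine0 (K : realType) (a b : K) :
  (a + b * t @[t --> (0 : K)^'] --> a)%classic.
Proof.
have -> : nbhs a = nbhs (a + b * 0) by rewrite mulr0 addr0.
apply: cvgD; first exact: cvg_cst.
apply: cvgM; first exact: cvg_cst.
exact: (cvg_trans (@nbhs_dnbhs _ (0 : K))).
Qed.

(** Only the [i]-th square varies along the [i]-th axis, so the difference quotient is exactly
    [k x_i + (k/2) t]. *)
Lemma derive_quadratic d (k : R) (x : 'rV[R]_d) (i : 'I_d) :
  derive ((fun y => k / 2 * sqnorm y) : 'rV[R]_d -> R^o) x (delta_mx 0 i) =
  k * x 0 i.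
Proof.
rewrite /derive; apply: cvg_lim => //.
have E (t : R) : t != 0 ->
    k * x 0 i + k / 2 * t = t^-1 *
      (k / 2 * sqnorm (t *: (delta_mx 0 i : 'rV[R]_d) + x) - k / 2 * sqnorm x).
  have S (y : 'rV[R]_d) :
      sqnorm y = y 0 i ^+ 2 + \sum_(j < d | j != i) y 0 j ^+ 2.
    by rewrite /sqnorm (bigD1 i).
  move=> t0; rewrite !S !mxE !eqxx/=.
  rewrite [X in t^-1 * (k / 2 * (_ + X) - _)](eq_bigr (fun j => x 0 j ^+ 2)).
    by field.
  by move=> j ji; rewrite !mxE (negbTE ji) andbF mulr0 add0r.
apply: cvg_trans (@cvg_affine0 R (k * x 0 i) (k / 2)); apply: near_eq_cvg.
by near=> t; apply: E; near: t; exact: nbhs_dnbhs_neq.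
Unshelve. all: by end_near. Qed.

Lemma grad_quadratic d (k : R) (x : 'rV[R]_d) :
  grad (fun y => k / 2 * sqnorm y) x = k *: x.
Proof. by apply/rowP => i; rewrite !mxE derive_quadratic. Qed.

(** * Factorization of the target and proposal densities over coordinates *)

Definition quad d (k : R) (x : 'rV[R]_d) : R := k / 2 * sqnorm x.

Definition gauss1 (k x : R) : R := (gauss_mass (k / 2))^-1 * expR (- (k / 2 * x ^+ 2)).

(** The normal density of mean [x - h k x] and variance [2h], i.e. one coordinate of the Langevin
    proposal. *)
Definition prop1 (k h x y : R) : R :=
  (gauss_mass (4 * h)^-1)^-1 * expR (- ((4 * h)^-1 * (y - (x - h * (k * x))) ^+ 2)).

Lemma gauss1_gt0 k x : 0 < k -> 0 < gauss1 k x.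
Proof. by move=> k0; rewrite mulr_gt0 ?expR_gt0// invr_gt0 gauss_mass_gt0// divr_gt0. Qed.

Lemma prop1_gt0 k h x y : 0 < h -> 0 < prop1 k h x y.
Proof.
move=> h0; rewrite mulr_gt0 ?expR_gt0// invr_gt0 gauss_mass_gt0//.
by rewrite invr_gt0 mulr_gt0.
Qed.

Lemma has_lint_gauss1 k : 0 < k -> has_lint (gauss1 k) 1.
Proof.
move=> k0; have k20 : 0 < k / 2 by rewrite divr_gt0.
have G0 := gauss_mass_gt0 k20.
have := has_lintZ (ltW (etrans (invr_gt0 _) G0)) (has_lint_gauss 0 k20).
rewrite mulVf ?gt_eqF//; congr has_lint.
by apply/funext => x; rewrite subr0.
Qed.

Lemma has_lint_prop1 k h x : 0 < h -> has_lint (prop1 k h x) 1.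
Proof.
move=> h0; have k20 : 0 < (4 * h)^-1 by rewrite invr_gt0 mulr_gt0.
have G0 := gauss_mass_gt0 k20.
have := has_lintZ (ltW (etrans (invr_gt0 _) G0))
  (has_lint_gauss (x - h * (k * x)) k20).
by rewrite mulVf ?gt_eqF.
Qed.

Lemma norm_const_quad d k : 0 < k ->
  norm_const (@quad d k) = gauss_mass (k / 2) ^+ d.
Proof.
move=> k0; have k20 : 0 < k / 2 by rewrite divr_gt0.
pose f (i : 'I_d) x := expR (- (k / 2 * (x - 0) ^+ 2)).
have := leb_int_prod (fun i : 'I_d => has_lint_gauss 0 k20 : has_lint (f i) _)
  (@ler01 R).
rewrite mul1r prodr_const card_ord /norm_const => E.
rewrite (_ : leb_int _ = (gauss_mass (k / 2) ^+ d)%:E)// -E.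
apply: eq_leb_int => v; rewrite mul1r -expR_sum /quad /sqnorm.
rewrite mulr_sumr -sumrN; congr (expR _)%:E.
by apply: eq_bigr => i _; rewrite subr0.
Qed.

Lemma pi_dens_quad d k (x : 'rV[R]_d) : 0 < k ->
  pi_dens (@quad d k) x = \prod_i gauss1 k (x 0 i).
Proof.
move=> k0; rewrite /pi_dens norm_const_quad// big_split/= prodr_const card_ord.
by rewrite -expR_sum /quad /sqnorm sumrN -mulr_sumr exprVn [RHS]mulrC.
Qed.

Lemma mala_prop_quad d k h (x y : 'rV[R]_d) : 0 < h ->
  mala_prop (@quad d k) h x y = \prod_i prop1 k h (x 0 i) (y 0 i).
Proof.
move=> h0; rewrite /mala_prop grad_quadratic big_split/= prodr_const card_ord.
rewrite -expR_sum; congr (_ * expR _).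
  have p0 : 0 <= 4 * pi * h :> R by rewrite !mulr_ge0 ?pi_ge0// ltW.
  rewrite powRN [d%:R / 2]mulrC powRrM powR12_sqrt// powR_mulrn ?sqrtr_ge0//.
  rewrite -exprVn /gauss_mass invrK; congr ((Num.sqrt _)^-1 ^+ _).
  by rewrite mulrA [pi * 4]mulrC.
rewrite /sqnorm mulr_suml -sumrN; apply: eq_bigr => i _.
by rewrite !mxE; congr (- _); rewrite mulrC; congr (_ * _ ^+ 2); ring.
Qed.

(** * Dirichlet form and relaxation time of MALA for a general potential *)

Section Reversibility.
Variables (d : nat) (f : 'rV[R]_d -> R) (h : R).

Lemma mala_acc_ge0 x y : 0 <= mala_acc f h x y.
Proof. by rewrite /mala_acc le_min ler01 expR_ge0. Qed.

Lemma mala_acc_le1 x y : mala_acc f h x y <= 1.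
Proof. by rewrite /mala_acc ge_min lexx. Qed.

Lemma mala_prop_ge0 x y : 0 <= mala_prop f h x y.
Proof. by rewrite mulr_ge0 ?powR_ge0 ?expR_ge0. Qed.

Lemma norm_const_ge0 : 0 <= norm_const f.
Proof. by apply: fine_ge0; apply: leb_int_ge0 => x; rewrite lee_fin expR_ge0. Qed.

Lemma pi_dens_ge0 x : 0 <= pi_dens f x.
Proof. by rewrite divr_ge0 ?expR_ge0 ?norm_const_ge0. Qed.

(* The acceptance factor replaces the flow from [x] to [y] by at most the proposal
   flow from [y] to [x], whose integral in [y] is an explicit Gaussian. *)
Lemma mala_flow_le x y :
  pi_dens f x * (mala_acc f h x y * mala_prop f h x y) <=
  pi_dens f y * mala_prop f h y x.
Proof.
pose e := expR (f x - f y + (sqnorm (y - x + h *: grad f x)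
                                - sqnorm (x - y + h *: grad f y)) / (4 * h)).
have ae : mala_acc f h x y <= e by rewrite /mala_acc ge_min lexx orbT.
(* Detailed balance for the untruncated Metropolis ratio [e]; the inequality then follows since the
   acceptance is at most [e]. *)
have -> : pi_dens f y * mala_prop f h y x =
    pi_dens f x * (e * mala_prop f h x y).
  have comb (K : fieldType) (p n u1 u2 v1 v2 v3 : K) :
      u1 * u2 = v1 * v2 * v3 -> u1 / n * (p * u2) = v1 / n * (v2 * (p * v3)).
    move=> E; rewrite (_ : u1 / n * _ = u1 * u2 * (p / n)); last by ring.
    by rewrite E; ring.
  have E : expR (- f y) * expR (- (sqnorm (x - y + h *: grad f y) / (4 * h))) =
      expR (- f x) * e * expR (- (sqnorm (y - x + h *: grad f x) / (4 * h))).
    by rewrite /e -!expRD; congr expR; ring.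
  exact: comb E.
by rewrite ler_wpM2l ?pi_dens_ge0// ler_wpM2r ?mala_prop_ge0.
Qed.

(** The rejection atom sits at [y = x], where the squared difference vanishes. *)
Lemma mala_kint_sqdiff (phi : 'rV[R]_d -> R) x :
  mala_kint f h x (fun y => ((phi x - phi y) ^+ 2)%:E) =
  leb_int (fun y => (mala_acc f h x y * mala_prop f h x y *
                      (phi x - phi y) ^+ 2)%:E).
Proof. by rewrite /mala_kint subrr expr0n/= mule0 adde0. Qed.

Lemma mala_kint_sqdiff_ge0 (phi : 'rV[R]_d -> R) x :
  (0 <= mala_kint f h x (fun y => ((phi x - phi y) ^+ 2)%:E))%E.
Proof.
rewrite mala_kint_sqdiff; apply: leb_int_ge0 => y.
by rewrite lee_fin mulr_ge0 ?sqr_ge0// mulr_ge0 ?mala_acc_ge0 ?mala_prop_ge0.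
Qed.

Lemma dirichlet_ge0 (phi : 'rV[R]_d -> R) : (0 <= dirichlet f h phi)%E.
Proof.
rewrite mule_ge0 ?lee_fin//; apply: leb_int_ge0 => x.
by rewrite mule_ge0 ?lee_fin ?pi_dens_ge0// mala_kint_sqdiff_ge0.
Qed.

Lemma dirichlet_le (phi : 'rV[R]_d -> R) (F : 'rV[R]_d -> \bar R) :
  (forall x, (pi_dens f x)%:E *
    leb_int (fun y => (mala_acc f h x y * mala_prop f h x y *
                      (phi x - phi y) ^+ 2)%:E) <= F x)%E ->
  (dirichlet f h phi <= (1 / 2)%:E * leb_int F)%E.
Proof.
move=> H; rewrite lee_wpmul2l ?lee_fin//; apply: le_leb_int => x.
  by rewrite mule_ge0 ?lee_fin ?pi_dens_ge0// mala_kint_sqdiff_ge0.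
by rewrite mala_kint_sqdiff.
Qed.

(** A single test function bounds the infimum defining the gap from above by [D / Var <= 1/T]. A
    zero gap gives an infinite relaxation time, so that case is immediate. *)
Lemma le_relaxation_time (phi : 'rV[R]_d -> R) (D T : R) :
  L2_nonconst f phi -> (dirichlet f h phi <= D%:E)%E -> 0 < T ->
  D * T <= pi_var f phi -> (T%:E <= relaxation_time f h)%E.
Proof.
move=> Lphi phiD T0 DT.
have var0 : 0 < pi_var f phi by case: Lphi => _ [].
have gap0 : (0 <= spectral_gap f h)%E.
  apply/ereal_infP => _ [psi [_ [_ v0]] <-].
  by rewrite mule_ge0 ?dirichlet_ge0// lee_fin invr_ge0 ltW.
have gapT : (spectral_gap f h <= (T^-1)%:E)%E.
  apply: (@le_trans _ _ (dirichlet f h phi * ((pi_var f phi)^-1)%:E)%E).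
    by apply: ereal_inf_lbound; exists phi.
  apply: (@le_trans _ _ (D%:E * ((pi_var f phi)^-1)%:E)%E).
    by rewrite lee_wpmul2r// lee_fin invr_ge0 ltW.
  by rewrite -EFinM lee_fin ler_pdivrMr// mulrC ler_pdivlMr.
have gapF : spectral_gap f h \is a fin_num.
  by rewrite ge0_fin_numE// (le_lt_trans gapT)// ltry.
rewrite /relaxation_time; case: eqP => [_|gapN0]; first by rewrite leey.
move: gap0 gapT gapN0; rewrite -(fineK gapF) !lee_fin/= => g0 gT gN0.
have g_gt0 : 0 < fine (spectral_gap f h).
  by rewrite lt_neqAle g0 andbT; apply/eqP => E; apply: gN0; rewrite -E.
by rewrite -[T]invrK lef_pV2// posrE invr_gt0.
Qed.

End Reversibility.

(** * Small steps: the first coordinate as test function *)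

Lemma leb_int_coord0 n (f : 'I_n.+1 -> R -> R) (g : R -> R) (c : R) :
  (forall i, has_lint (f i) 1) -> has_lint (fun x => f ord0 x * g x) c ->
  leb_int (fun v : 'rV[R]_n.+1 => ((\prod_i f i (v 0 i)) * g (v 0 ord0))%:E) =
  c%:E.
Proof.
move=> If Ig.
pose F i := if i == ord0 then fun x => f ord0 x * g x else f i.
have IF i : has_lint (F i) (if i == ord0 then c else 1).
  by rewrite /F; case: eqP.
have := leb_int_prod IF (@ler01 R).
rewrite mul1r big_ord_recl eqxx big1 ?mulr1// => <-.
apply: eq_leb_int => v; rewrite mul1r !big_ord_recl /F eqxx/=.
by rewrite mulrAC; congr (_ * _ * _)%:E.
Qed.

(** Halving the rate multiplies the mass by [sqrt 2], which is below [3/2]. *)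
Lemma gauss_mass_half a : 0 < a -> gauss_mass (a / 2) <= 3 / 2 * gauss_mass a.
Proof.
move=> a0.
have -> : 3 / 2 * gauss_mass a = Num.sqrt ((3 / 2) ^+ 2 * (pi / a)).
  by rewrite sqrtrM ?sqr_ge0// sqrtr_sqr ger0_norm.
rewrite ler_wsqrtr//.
rewrite (_ : pi / (a / 2) = 2 * (pi / a)); last by field; rewrite gt_eqF.
by apply: ler_wpM2r; [rewrite divr_ge0 ?pi_ge0// ltW|lra].
Qed.

(** The exact second moment is [1 / (2a)]; the cruder [3 / a] has the right order in [a] and follows
    from a pointwise bound. *)
Lemma has_lint_gauss_sqr a m : 0 < a ->
  exists2 c, has_lint (fun x : R =>
    (gauss_mass a)^-1 * expR (- (a * (x - m) ^+ 2)) * (x - m) ^+ 2) c & c <= 3 / a.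
Proof.
move=> a0; have a20 : 0 < a / 2 by rewrite divr_gt0.
have G0 := gauss_mass_gt0 a0.
have C0 : 0 <= 2 / a / gauss_mass a by rewrite !divr_ge0// ltW.
have [||c Ic /andP[_ cle]] := le_has_lint _ _
  (has_lintZ C0 (has_lint_gauss m a20))
  (f := fun x : R => (gauss_mass a)^-1 * expR (- (a * (x - m) ^+ 2)) * (x - m) ^+ 2).
- apply: measurable_funM; last first.
    by apply: measurable_funX; exact: measurable_funB.
  have [mg _ _] := has_lint_gauss m a0.
  exact: measurable_funM.
- move=> x; apply/andP; split.
    by rewrite mulr_ge0 ?sqr_ge0// mulr_ge0 ?expR_ge0// invr_ge0 ltW.
  set w := (x - m) ^+ 2; have w0 : 0 <= w by rewrite sqr_ge0.
  have E : expR (- (a / 2 * w)) = expR (- (a * w)) * expR (a / 2 * w).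
    by rewrite -expRD; congr expR; field.
  rewrite E (_ : _ * (expR _ * _) = (gauss_mass a)^-1 * expR (- (a * w)) *
     (2 / a * expR (a / 2 * w))); last by ring.
  apply: ler_wpM2l; first by rewrite mulr_ge0 ?expR_ge0// invr_ge0 ltW.
  (* [t <= exp t] at [t = a w / 2] trades the square for a wider Gaussian. *)
  have := expR_ge1Dx (a / 2 * w).
  have a2 : 0 <= 2 / a by rewrite divr_ge0// ltW.
  move=> /(ler_wpM2l a2); apply: le_trans.
  rewrite mulrDr mulr1 mulrA (_ : 2 / a * (a / 2) = 1) ?mul1r ?lerDr//.
  by field; rewrite gt_eqF.
- exists c => //; apply: (le_trans cle).
  rewrite (_ : 3 / a = 2 / a / gauss_mass a * (3 / 2 * gauss_mass a)).
    by rewrite ler_wpM2l// gauss_mass_half.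
  by field; rewrite !gt_eqF.
Qed.

(** The lower bound is uniform in the centre [m], so the mean of the test function never has to be
    computed. *)
Lemma gauss1_var_ge (m : R) :
  exists2 c, has_lint (fun x : R => gauss1 1 x * (x - m) ^+ 2) c &
    (gauss_mass (1 / 2))^-1 * expR (- 2) <= c.
Proof.
have h0 : 0 < 1 / 2 :> R by rewrite divr_gt0.
have G0 := gauss_mass_gt0 h0.
have [c2 I2 _] := has_lint_gauss_sqr 0 h0.
have I1 := has_lint_gauss1 (@ltr01 R).
have m20 : 0 <= 2 * m ^+ 2 :> R by rewrite mulr_ge0// sqr_ge0.
(* The majorant from [(x - m)^2 <= 2 x^2 + 2 m^2] serves only to make the integral finite. *)
have [||c Ic _] := le_has_lint _ _
  (has_lintD (has_lintZ (ler0n R 2) I2) (has_lintZ m20 I1))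
  (f := fun x : R => gauss1 1 x * (x - m) ^+ 2).
- have [mg _ _] := I1; apply: measurable_funM => //.
  by apply: measurable_funX; exact: measurable_funB.
- move=> x; have g0 := gauss1_gt0 x (@ltr01 R).
  apply/andP; split; first by rewrite mulr_ge0 ?sqr_ge0// ltW.
  rewrite !subr0 -/(gauss1 1 x).
  rewrite (_ : 2 * _ + _ = gauss1 1 x * (2 * x ^+ 2 + 2 * m ^+ 2)); last first.
    by rewrite /gauss1; ring.
  rewrite ler_pM2l// -subr_ge0 (_ : _ - _ = (x + m) ^+ 2) ?sqr_ge0//.
  by ring.
- exists c => //.
  have C0 : 0 <= (gauss_mass (1 / 2))^-1 * expR (- 2).
    by rewrite mulr_ge0 ?expR_ge0// invr_ge0 ltW.
  (* On the unit interval chosen on the side opposite to [m], [|x - m| >= 1]. *)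
  pose a : R := if 0 <= m then - 2 else 1.
  have a1 : a + 1 - a = 1 by ring.
  have aa : a <= a + 1 by rewrite lerDl.
  have := has_lintZ C0 (has_lint_indic aa); rewrite a1 mulr1 => Ia.
  apply: (has_lint_le Ia Ic).
  move=> x; rewrite indicE.
  rewrite (_ : (x \in _) = (a <= x <= a + 1)); last first.
    by apply/idP/idP; rewrite inE/= in_itv.
  case: (boolP (a <= x <= a + 1)) => [/andP[ax xa]|_] /=; last first.
    by rewrite mulr0 mulr_ge0 ?sqr_ge0// ltW// gauss1_gt0.
  (* Both possible intervals, [[-2, -1]] and [[1, 2]], lie in [|x| <= 2]; hence the factor
     [exp(-2)]. *)
  have [x2 xm] : x ^+ 2 <= 4 /\ 1 <= (x - m) ^+ 2.
    by move: ax xa; rewrite /a; case: (leP 0 m) => ? ? ?; split; nra.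
  rewrite mulr1 /gauss1 -[leLHS]mulr1.
  apply: ler_pM => //; apply: ler_wpM2l; first by rewrite invr_ge0 ltW.
  by rewrite ler_expR; lra.
Qed.

(** The displacement is noise plus the drift [-h x], and the square of a sum is at most twice the
    sum of squares. The noise has second moment at most [3 * 4h = 12h], which doubles to [24h]. *)
Lemma prop1_sqdiff h x : 0 < h ->
  exists2 c, has_lint (fun y : R => prop1 1 h x y * (x - y) ^+ 2) c &
    0 <= c <= 24 * h + 2 * h ^+ 2 * x ^+ 2.
Proof.
move=> h0; have h40 : 0 < (4 * h)^-1 by rewrite invr_gt0 mulr_gt0.
have [c2 I2 c2h] := has_lint_gauss_sqr (x - h * (1 * x)) h40.
have I1 := has_lint_prop1 1 x h0.
have hx0 : 0 <= 2 * h ^+ 2 * x ^+ 2 by apply: mulr_ge0; rewrite ?sqr_ge0// mulr_ge0 ?sqr_ge0.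
have [||c Ic /andP[c0 cle]] := le_has_lint _ _
  (has_lintD (has_lintZ (ler0n R 2) I2) (has_lintZ hx0 I1))
  (f := fun y : R => prop1 1 h x y * (x - y) ^+ 2).
- have [mg _ _] := I1; apply: measurable_funM => //.
  by apply: measurable_funX; exact: measurable_funB.
- move=> y; have q0 := prop1_gt0 1 x y h0.
  apply/andP; split; first by rewrite mulr_ge0 ?sqr_ge0// ltW.
  rewrite -/(prop1 1 h x y).
  rewrite (_ : 2 * _ + _ = prop1 1 h x y *
    (2 * (y - (x - h * (1 * x))) ^+ 2 + 2 * h ^+ 2 * x ^+ 2)); last by ring.
  rewrite ler_pM2l// -subr_ge0.
  rewrite (_ : _ - _ = (y - (x - h * (1 * x)) + h * x) ^+ 2) ?sqr_ge0//.
  by ring.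
- exists c => //; rewrite c0; apply: (le_trans cle); rewrite mulr1 lerD2r.
  by move: c2h; rewrite invrK; lra.
Qed.

(** The Gaussian second moment is at most 6, and [h^2 <= h] turns [24h + 12h^2] into [36h]. *)
Lemma gauss1_moment2 h : 0 < h -> h <= 1 ->
  exists2 c, has_lint (fun x => gauss1 1 x * (24 * h + 2 * h ^+ 2 * x ^+ 2)) c &
    c <= 36 * h.
Proof.
move=> h0 h1; have a0 : 0 < 1 / 2 :> R by rewrite divr_gt0.
have [c2 I2 c2h] := has_lint_gauss_sqr 0 a0.
have I1 := has_lint_gauss1 (@ltr01 R).
have h24 : 0 <= 24 * h by rewrite mulr_ge0// ltW.
have h2 : 0 <= 2 * h ^+ 2 by rewrite mulr_ge0// sqr_ge0.
have := has_lintD (has_lintZ h24 I1) (has_lintZ h2 I2) => I.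
exists (24 * h * 1 + 2 * h ^+ 2 * c2).
  move: I; congr has_lint; apply/funext => x.
  by rewrite !subr0 -/(gauss1 1 x); ring.
have c26 : c2 <= 6 by apply: (le_trans c2h); lra.
have : 2 * h ^+ 2 * c2 <= 2 * h ^+ 2 * 6 by rewrite ler_wpM2l.
by have : h ^+ 2 <= h by [rewrite expr2 ler_piMr// ltW]; lra.
Qed.

Lemma relaxation_time_small_step n h T : 0 < h -> h <= 1 -> 0 < T ->
  18 * h * T <= (gauss_mass (1 / 2))^-1 * expR (- 2) ->
  (T%:E <= relaxation_time (@quad n.+1 1%R) h)%E.
Proof.
move=> h0 h1 T0 hT; pose phi (x : 'rV[R]_n.+1) : R := x 0 ord0.
have If (i : 'I_n.+1) := has_lint_gauss1 (@ltr01 R).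
have moment m : exists2 c, leb_int (fun x => (pi_dens (@quad n.+1 1%R) x *
    (phi x - m) ^+ 2)%:E) = c%:E & (gauss_mass (1 / 2))^-1 * expR (- 2) <= c.
  have [c Ic vc] := gauss1_var_ge m; exists c => //.
  rewrite -(leb_int_coord0 If Ic); apply: eq_leb_int => v.
  by rewrite pi_dens_quad.
have [v Ev vge] := moment (pi_mean (@quad n.+1 1%R) phi).
have varE : pi_var (@quad n.+1 1%R) phi = v by rewrite /pi_var Ev.
have [c Ic ch] := gauss1_moment2 h0 h1.
(* Here [18h] is half of [36h], the half coming from the Dirichlet form. *)
apply: (@le_relaxation_time _ _ _ phi (18 * h)) => //; last first.
  by rewrite varE (le_trans hT).
- apply: (@le_trans _ _ ((1 / 2)%:E * c%:E)%E); last by rewrite -EFinM lee_fin; lra.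
  rewrite -(leb_int_coord0 If Ic); apply: dirichlet_le => x.
  have [b Ib /andP[b0 bh]] := prop1_sqdiff (x 0 ord0) h0.
  have := leb_int_coord0 (fun i => has_lint_prop1 1 (x 0 i) h0) Ib => Eb.
  apply: (@le_trans _ _ ((pi_dens (@quad n.+1 1%R) x)%:E * b%:E)%E).
    apply: lee_wpmul2l; first by rewrite lee_fin pi_dens_ge0.
    (* Bounding the acceptance by 1 leaves the proposal density, which is a product over
       coordinates. *)
    rewrite -Eb; apply: le_leb_int => y.
      by rewrite lee_fin mulr_ge0 ?sqr_ge0// mulr_ge0 ?mala_acc_ge0 ?mala_prop_ge0.
    rewrite lee_fin -mala_prop_quad// ler_wpM2r ?sqr_ge0//.
    by rewrite ler_piMl ?mala_prop_ge0 ?mala_acc_le1.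
  by rewrite -EFinM lee_fin pi_dens_quad// ler_wpM2l// -pi_dens_quad// pi_dens_ge0.
split; last split.
- rewrite (_ : (fun _ => _) = fun t : n.+1.-tuple (measurableTypeR R) => tnth t ord0).
    exact: measurable_tnth.
  by apply/funext => t; rewrite /phi mxE.
- have [w Ew _] := moment 0; rewrite (_ : leb_int _ = w%:E) ?ltry// -Ew.
  by apply: eq_leb_int => x; rewrite subr0.
- rewrite varE (lt_le_trans _ vge)// mulr_gt0 ?expR_gt0// invr_gt0.
  by rewrite gauss_mass_gt0// divr_gt0.
Qed.

(** * Large steps: the indicator of a small cube as test function *)

(** Tonelli: the integral of the marginal [beta], known only through [f], is read off from the other
    marginal [alpha]. *)
Lemma has_lint_swap (K : realType) (f : K -> K -> K) (alpha beta : K -> K) (c : K) :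
  measurable_fun setT (fun z : K * K => f z.1 z.2) ->
  (forall x, has_lint (f x) (beta x)) ->
  (forall y, has_lint (fun x => f x y) (alpha y)) ->
  has_lint alpha c -> has_lint beta c.
Proof.
move=> mf fb fa [_ _ ac].
have f0 x y : 0 <= f x y by case: (fb x).
have mF : measurable_fun setT (fun z : K * K => (f z.1 z.2)%:E).
  exact/measurable_EFinP.
have F0 (z : K * K) : (0 <= (f z.1 z.2)%:E)%E by rewrite lee_fin.
have E x : (\int[@lebesgue_measure K]_y (f x y)%:E = (beta x)%:E)%E.
  by case: (fb x).
split.
- apply/measurable_EFinP.
  have := measurable_fun_fubini_tonelli_F (m2 := @lebesgue_measure K) _ mF F0.
  by congr measurable_fun; apply/funext => x; rewrite /fubini_F/= E.
- by move=> x; exact: has_lint_ge0 (fb x).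
- under eq_integral do rewrite -E.
  rewrite (fubini_tonelli (m1 := @lebesgue_measure K) (m2 := @lebesgue_measure K)
    (fun z => (f z.1 z.2)%:E))//= -ac.
  by apply: eq_integral => y _; case: (fa y).
Qed.

Lemma measurable_gauss_kernel (K : realType) (a b c e l k rho : K) :
  measurable_fun setT (fun z : K * K => a * expR (- (b * z.1 ^+ 2)) *
    (c * expR (- (e * (z.2 - (z.1 - l * (k * z.1))) ^+ 2))) * \1_`[0, rho]%classic z.2).
Proof.
have m1 : measurable_fun setT (fun z : K * K => z.1) by exact: measurable_fst.
have m2 : measurable_fun setT (fun z : K * K => z.2) by exact: measurable_snd.
apply: measurable_funM; last first.
  by apply: measurableT_comp => //; exact: measurable_indic.
apply: measurable_funM; apply: measurable_funM => //; apply: measurableT_comp => //;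
  apply: measurableT_comp => //; apply: measurable_funM => //; apply: measurable_funX => //.
apply: measurable_funB => //; apply: measurable_funB => //.
by apply: measurable_funM => //; exact: measurable_funM.
Qed.

(** Complete the square in [y]. With [u = h k], the exponent is [(1 + u^2)/(4h)] times a square
    centred at [(1 - u) x / (1 + u^2)], plus [k x^2 / (2 (1 + u^2))]. At [x = 0] the result is the
    target density times [1 / sqrt(1 + u^2)], the gain per coordinate. *)
Lemma reverse_marginal (k h x : R) : 0 < k -> 0 < h ->
  exists2 A, has_lint (fun y => gauss1 k y * prop1 k h y x)
    (A * expR (- (k / (2 * (1 + (h * k) ^+ 2)) * x ^+ 2))) &
    A = (Num.sqrt (1 + (h * k) ^+ 2))^-1 / gauss_mass (k / 2).
Proof.
move=> k0 h0; set u := h * k.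
have u0 : 0 < 1 + u ^+ 2 by rewrite ltr_pwDl// sqr_ge0.
have h40 : 0 < (4 * h)^-1 by rewrite invr_gt0 mulr_gt0.
have a0 : 0 < (1 + u ^+ 2) * (4 * h)^-1 by rewrite mulr_gt0.
have G1 : 0 < gauss_mass (k / 2) by rewrite gauss_mass_gt0// divr_gt0.
have G2 := gauss_mass_gt0 h40.
pose B := expR (- (k / (2 * (1 + u ^+ 2)) * x ^+ 2)).
have C0 : 0 <= (gauss_mass (k / 2))^-1 / gauss_mass (4 * h)^-1 * B.
  by apply: mulr_ge0; rewrite ?expR_ge0// mulr_ge0// invr_ge0 ltW.
have := has_lintZ C0 (has_lint_gauss ((1 - u) * x / (1 + u ^+ 2)) a0).
set A := (_^-1 / gauss_mass (k / 2)) => I; exists A => //.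
move: I; congr has_lint.
  apply/funext => y; rewrite /gauss1 /prop1 /B.
  rewrite [RHS](_ : _ = (gauss_mass (k / 2))^-1 / gauss_mass (4 * h)^-1 *
    (expR (- (k / 2 * y ^+ 2)) *
     expR (- ((4 * h)^-1 * (x - (y - h * (k * y))) ^+ 2)))); last by ring.
  rewrite -[LHS]mulrA -!expRD; congr (_ * expR _); rewrite /u; field.
  by rewrite !gt_eqF.
rewrite mulrAC; congr (_ * _); rewrite /A mulrC mulrA [RHS]mulrC.
rewrite [X in X * _]mulrC.
have -> : gauss_mass ((1 + u ^+ 2) * (4 * h)^-1) =
    gauss_mass (4 * h)^-1 * (Num.sqrt (1 + u ^+ 2))^-1.
  rewrite /gauss_mass -sqrtrV ?ltW// -sqrtrM ?divr_ge0 ?pi_ge0 ?ltW//.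
  by congr Num.sqrt; field; rewrite !gt_eqF.
field; rewrite !gt_eqF// sqrtr_gt0//.
Qed.

(** Separates moves that start in the cube from moves that end in it. *)
Lemma sqr_diff01 (a b : R) : a = 0 \/ a = 1 -> b = 0 \/ b = 1 ->
  (a - b) ^+ 2 <= a + b.
Proof.
by move=> [->|->] [->|->]; rewrite ?subrr ?subr0 ?sub0r ?sqrrN ?expr0n ?expr1n
  ?addr0 ?add0r// addr_ge0.
Qed.

Section LargeStep.
Variables (d : nat) (k h rho : R).
Hypotheses (d_gt0 : (0 < d)%N) (k_gt0 : 0 < k) (h_gt0 : 0 < h) (rho_gt0 : 0 < rho).
Hypotheses (rhoZ : rho / gauss_mass (k / 2) <= 1 / 2)
  (rho_small : k * rho ^+ 2 * d%:R <= 1).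

Let Z := gauss_mass (k / 2).
Let r := (Num.sqrt (1 + (h * k) ^+ 2))^-1.
Let I : R -> R := \1_`[0, rho]%classic.
Let f := @quad d k.
Let phi (x : 'rV[R]_d) : R := \prod_i I (x 0 i).
Let s (x y : R) : R := gauss1 k x * prop1 k h x y.

Let Z_gt0 : 0 < Z. Proof. by rewrite gauss_mass_gt0// divr_gt0. Qed.

Let I01 x : I x = 0 \/ I x = 1.
Proof. by rewrite /I indicE; case: (_ \in _); [right|left]. Qed.

Let I_ge0 x : 0 <= I x. Proof. by case: (I01 x) => ->. Qed.

Let phi01 x : phi x = 0 \/ phi x = 1.
Proof.
apply: (big_ind (fun z => z = 0 \/ z = 1)) => [|a b|i _]; [by right| |exact: I01].
by move=> [->|->] [->|->]; rewrite ?mul0r ?mulr0 ?mul1r; [left|left|left|right].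
Qed.

Let has_lint_I : has_lint I rho.
Proof. by have := has_lint_indic (ltW rho_gt0); rewrite subr0. Qed.

Let rZ_ge0 : 0 <= r / Z.
Proof. by rewrite divr_ge0 ?invr_ge0 ?sqrtr_ge0// ltW. Qed.

Let s_ge0 x y : 0 <= s x y.
Proof. by rewrite mulr_ge0// ltW// ?gauss1_gt0 ?prop1_gt0. Qed.

(** On [[0, rho]] the density lies between [e / Z] and [1 / Z]. Smallness of [rho] keeps
    [e^d >= 1/2], so the [d]-dimensional cube loses only a factor 2. *)
Let box_mass : exists2 p, has_lint (fun x => gauss1 k x * I x) p &
  [/\ 0 < p, p <= 1 / 2 & (rho / Z) ^+ d <= 2 * p ^+ d].
Proof.
have [mg g0 _] := has_lint_gauss1 k_gt0; have [mI _ _] := has_lint_I.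
have Zi0 : 0 <= Z^-1 by rewrite invr_ge0 ltW.
have ge0 x : 0 <= gauss1 k x * I x by rewrite mulr_ge0// ltW.
have le_gI x : gauss1 k x * I x <= Z^-1 * I x.
  apply: ler_wpM2r => //; rewrite /gauss1 -/Z ler_piMr//.
  by rewrite -[leRHS]expR0 ler_expR oppr_le0 mulr_ge0 ?sqr_ge0// divr_ge0// ltW.
have [||p Ip /andP[p0 ple]] := le_has_lint _ _ (has_lintZ Zi0 has_lint_I)
  (f := fun x => gauss1 k x * I x).
- exact: measurable_funM.
- by move=> x; rewrite ge0 le_gI.
pose e := expR (- (k / 2 * rho ^+ 2)).
have Ze0 : 0 <= Z^-1 * e by rewrite mulr_ge0// expR_ge0.
have lep : Z^-1 * e * rho <= p.
  apply: (has_lint_le (has_lintZ Ze0 has_lint_I) Ip) => x.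
  rewrite /I indicE (_ : (x \in _) = (0 <= x <= rho)); last first.
    by apply/idP/idP; rewrite inE/= in_itv.
  case: (boolP (0 <= x <= rho)) => [/andP[x0 xr]|_] /=; last by rewrite !mulr0.
  rewrite !mulr1 /gauss1 -/Z; apply: ler_wpM2l => //.
  rewrite ler_expR lerN2; apply: ler_wpM2l; first by rewrite divr_ge0// ltW.
  by rewrite -subr_ge0 subr_sqr mulr_ge0// ?subr_ge0// addr_ge0// ltW.
exists p => //; split.
- by apply: lt_le_trans lep; rewrite !mulr_gt0 ?invr_gt0 ?expR_gt0.
- by apply: le_trans ple _; rewrite mulrC.
- have : (Z^-1 * e * rho) ^+ d <= p ^+ d.
    by rewrite lerXn2r// nnegrE// mulr_ge0// ltW.
  have -> : Z^-1 * e * rho = e * (rho / Z) by ring.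
  rewrite exprMn => H.
  (* By [exp t >= 1 + t] and [k rho^2 d <= 1]. *)
  have ed : 1 / 2 <= e ^+ d.
    rewrite /e -expRM_natl; apply: le_trans (expR_ge1Dx _).
    have -> : d%:R * - (k / 2 * rho ^+ 2) = - (k * rho ^+ 2 * d%:R / 2) by field.
    have half z : z <= 1 -> 1 / 2 <= 1 + - (z / 2) :> R by lra.
    exact: half.
  have : 1 / 2 * (rho / Z) ^+ d <= e ^+ d * (rho / Z) ^+ d.
    by rewrite ler_wpM2r// exprn_ge0// divr_ge0// ltW.
  by lra.
Qed.

(** Here [al x] is the proposal flow arriving at [x] and [be x] the flow from [x] into the interval.
    Integrating [al] over the interval and [be] over the line gives the same [c], and [al <= r / Z]
    bounds it. *)
Let flow_marginals : exists (al be : R -> R) (c : R),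
  [/\ forall x, has_lint (fun y => s y x) (al x),
      forall x, has_lint (fun y => s x y * I y) (be x),
      has_lint (fun x => I x * al x) c, has_lint be c & c <= r * (rho / Z)].
Proof.
pose b := k / (2 * (1 + (h * k) ^+ 2)).
pose al x := r / Z * expR (- (b * x ^+ 2)).
have Ial x : has_lint (fun y => s y x) (al x).
  by have [A IA EA] := reverse_marginal x k_gt0 h_gt0; rewrite /al -EA.
have b0 : 0 < b by rewrite divr_gt0// mulr_gt0// ltr_pwDl// sqr_ge0.
have [mI _ _] := has_lint_I.
have al0 x : 0 <= al x by rewrite mulr_ge0// expR_ge0.
have [||c Ic /andP[_ cle]] := le_has_lint _ _ (has_lintZ rZ_ge0 has_lint_I)
  (f := fun x => I x * al x).
- apply: measurable_funM => //; apply: measurable_funM => //.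
  have [mg _ _] := has_lint_gauss 0 b0.
  by move: mg; congr measurable_fun; apply/funext => x; rewrite subr0.
- move=> x; rewrite mulr_ge0//= mulrC ler_wpM2r// ler_piMr//.
  by rewrite -[leRHS]expR0 ler_expR oppr_le0 mulr_ge0 ?sqr_ge0// ltW.
(* No formula for [be] is required: domination gives a value at each [x], and choice collects these
   into a function. *)
have Ibe x : exists be, has_lint (fun y => s x y * I y) be.
  have Is := has_lintZ (ltW (gauss1_gt0 x k_gt0)) (has_lint_prop1 k x h_gt0).
  have [||be Ibe _] := le_has_lint _ _ Is (f := fun y => s x y * I y).
  - by apply: measurable_funM => //; case: Is.
  - move=> y; rewrite mulr_ge0//= ler_piMr//.
    by case: (I01 y) => ->.
  - by exists be.
have [be beP] := choice Ibe.
exists al, be, c; split=> //; last by rewrite mulrCA mulrC.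
apply: (@has_lint_swap R (fun x y => s x y * I y) (fun x => I x * al x)) => //.
  exact: (@measurable_gauss_kernel R Z^-1 (k / 2) (gauss_mass (4 * h)^-1)^-1
    (4 * h)^-1 h k rho).
move=> y; have := has_lintZ (I_ge0 y) (Ial y); congr has_lint.
by apply/funext => x; rewrite mulrC.
Qed.

Let prod_s (x y : 'rV[R]_d) :
  \prod_i s (x 0 i) (y 0 i) = pi_dens f x * mala_prop f h x y.
Proof. by rewrite pi_dens_quad// mala_prop_quad// -big_split. Qed.

(** For moves starting in the cube, the accepted flow is replaced by the reversed proposal flow; for
    moves ending there, the acceptance is bounded by 1. Each part integrates to [c^d], and the
    factor [1/2] averages them. *)
Let phi_dirichlet : (dirichlet f h phi <= ((r * (rho / Z)) ^+ d)%:E)%E.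
Proof.
have [al [be [c [Ial Ibe Ic Ibec cle]]]] := flow_marginals.
have c0 := has_lint_ge0 Ibec.
pose F (x : 'rV[R]_d) := (1 * (\prod_i (I (x 0 i) * al (x 0 i))) +
  1 * (\prod_i be (x 0 i)))%:E.
have EF : leb_int F = (1 * c ^+ d + 1 * c ^+ d)%:E.
  rewrite /F (leb_int_prod2 (fun i : 'I_d => Ic) (fun i : 'I_d => Ibec))//.
  by rewrite !prodr_const card_ord.
apply: (@le_trans _ _ ((1 / 2)%:E * leb_int F)%E); last first.
  have cd : c ^+ d <= (r * (rho / Z)) ^+ d.
    by rewrite lerXn2r// nnegrE// (le_trans c0).
  have half a b : a <= b -> 1 / 2 * (1 * a + 1 * a) <= b :> R by lra.
  by rewrite EF -EFinM lee_fin half.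
apply: dirichlet_le => x.
have fx0 : 0 < pi_dens f x.
  by rewrite pi_dens_quad//; apply: prodr_gt0 => i _; exact: gauss1_gt0.
have phi0 y : 0 <= phi y by case: (phi01 y) => ->.
have phi1 y : phi y <= 1 by case: (phi01 y) => ->.
(* The target density at [x] stands outside the inner integral, hence the division by it. *)
pose G (y : 'rV[R]_d) := (phi x / pi_dens f x * (\prod_i s (y 0 i) (x 0 i)) +
  (pi_dens f x)^-1 * (\prod_i (s (x 0 i) (y 0 i) * I (y 0 i))))%:E.
have le_G y : mala_acc f h x y * mala_prop f h x y * (phi x - phi y) ^+ 2 <=
    phi x / pi_dens f x * (\prod_i s (y 0 i) (x 0 i)) +
    (pi_dens f x)^-1 * (\prod_i (s (x 0 i) (y 0 i) * I (y 0 i))).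
  rewrite [\prod_i (s _ _ * _)]big_split/= -/(phi y) !prod_s.
  have a0 := mala_acc_ge0 f h x y; have a1 := mala_acc_le1 f h x y.
  have q0 := mala_prop_ge0 f h x y.
  have fl := mala_flow_le f h x y.
  have sq : (phi x - phi y) ^+ 2 <= phi x + phi y.
    exact: sqr_diff01.
  apply: (le_trans (ler_wpM2l (mulr_ge0 a0 q0) sq)); rewrite mulrDr lerD//.
    rewrite mulrC -mulrA; apply: ler_wpM2l => //.
    by rewrite [leRHS]mulrC ler_pdivlMr// mulrC.
  rewrite -[X in _ <= _ * X]mulrA mulKf ?gt_eqF//; apply: ler_wpM2r => //.
  by rewrite ler_piMl.
apply: (@le_trans _ _ ((pi_dens f x)%:E * leb_int G)%E).
  apply: lee_wpmul2l; first by rewrite lee_fin ltW.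
  apply: le_leb_int => y; last by rewrite lee_fin.
  by rewrite lee_fin mulr_ge0 ?sqr_ge0// mulr_ge0 ?mala_acc_ge0 ?mala_prop_ge0.
rewrite /G (leb_int_prod2 (fun i : 'I_d => Ial (x 0 i)) (fun i : 'I_d => Ibe (x 0 i)));
  [|by rewrite divr_ge0// ltW|by rewrite invr_ge0 ltW].
rewrite -EFinM lee_fin big_split/= -/(phi x) !mul1r.
rewrite (_ : pi_dens f x * _ = phi x * (\prod_i al (x 0 i)) + \prod_i be (x 0 i))//.
by field; rewrite gt_eqF.
Qed.

(** The cube has mass [p^d <= 1/2], so the variance is at least [p^d / 2]. The Dirichlet form is at
    most [2 r^d p^d], which bounds the gap by [4 r^d]. *)
Lemma relaxation_time_large_step T : 0 < T -> r ^+ d * T <= 1 / 4 ->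
  (T%:E <= relaxation_time f h)%E.
Proof.
move=> T0 rT; have [p Ip [p0 p12 pd]] := box_mass.
have phi2 x : phi x ^+ 2 = phi x.
  by case: (phi01 x) => ->; rewrite ?expr0n ?expr1n.
(* Since [phi^2 = phi], both moments and the centred square are affine in [phi]. The weight
   [1 - 2 p^d] of the latter is nonnegative because [p^d <= 1/2]. *)
have moment a b : 0 <= a -> 0 <= b ->
    leb_int (fun x => (pi_dens f x * (a * phi x + b))%:E) = (a * p ^+ d + b)%:E.
  move=> a0 b0.
  have := leb_int_prod2 (fun i : 'I_d => Ip)
    (fun i : 'I_d => has_lint_gauss1 k_gt0) a0 b0.
  rewrite !prodr_const card_ord expr1n mulr1 => <-; apply: eq_leb_int => x.
  rewrite big_split/= -!pi_dens_quad// -/(phi x) -/f; congr (_%:E); ring.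
have m : pi_mean f phi = p ^+ d.
  rewrite /pi_mean (_ : leb_int _ = (p ^+ d)%:E)//.
  have := moment 1 0 ler01 (lexx 0); rewrite mul1r addr0 => <-.
  by apply: eq_leb_int => x; rewrite mul1r addr0.
have pd0 : 0 < p ^+ d by rewrite exprn_gt0.
have pd12 : p ^+ d <= 1 / 2.
  case: d d_gt0 => // n _; rewrite exprSr; apply: (le_trans _ p12).
  have p1 : p <= 1 by apply: (le_trans p12); lra.
  by rewrite ler_piMl ?exprn_ile1// ltW.
have v : pi_var f phi = p ^+ d - (p ^+ d) ^+ 2.
  rewrite /pi_var m (_ : leb_int _ = (p ^+ d - (p ^+ d) ^+ 2)%:E)//.
  have a0 : 0 <= 1 - 2 * p ^+ d by lra.
  rewrite (_ : p ^+ d - _ = (1 - 2 * p ^+ d) * p ^+ d + (p ^+ d) ^+ 2); last by ring.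
  rewrite -moment ?sqr_ge0//; apply: eq_leb_int => x; congr (_ * _)%:E.
  by rewrite sqrrB phi2; ring.
have vge : p ^+ d / 2 <= pi_var f phi.
  rewrite v (_ : p ^+ d - _ = p ^+ d * (1 - p ^+ d)); last by ring.
  by rewrite ler_pM2l//; lra.
apply: (@le_relaxation_time _ _ _ phi ((r * (rho / Z)) ^+ d)) => //; last first.
  rewrite exprMn mulrAC; apply: le_trans vge.
  have H : r ^+ d * T * (rho / Z) ^+ d <= 1 / 4 * (2 * p ^+ d).
    apply: ler_pM => //; last by rewrite exprn_ge0// divr_ge0// ltW.
    by apply: mulr_ge0; [rewrite exprn_ge0// invr_ge0 sqrtr_ge0|exact: ltW].
  by apply: (le_trans H); lra.
split; last split.
- rewrite (_ : (fun _ => _) = fun t : d.-tuple (measurableTypeR R) =>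
    \prod_(i <- enum 'I_d) (I (tnth t i))); last first.
    by apply/funext => t; rewrite /phi big_enum; apply: eq_bigr => i _; rewrite mxE.
  have [mI _ _] := has_lint_I.
  apply: (@measurable_prod _ _ R) => i _.
  by apply: measurableT_comp => //; exact: measurable_tnth.
- rewrite (_ : leb_int _ = (p ^+ d)%:E) ?ltry//.
  have := moment 1 0 ler01 (lexx 0); rewrite mul1r addr0 => <-.
  by apply: eq_leb_int => x; rewrite mul1r addr0 phi2.
- by apply: lt_le_trans vge; rewrite divr_gt0.
Qed.

End LargeStep.

(** The bound does not involve the side of the cube, so any small enough [rho] will do. *)
Lemma relaxation_time_curved d k h T : (0 < d)%N -> 0 < k -> 0 < h -> 0 < T ->
  (Num.sqrt (1 + (h * k) ^+ 2))^-1 ^+ d * T <= 1 / 4 ->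
  (T%:E <= relaxation_time (@quad d k) h)%E.
Proof.
move=> d0 k0 h0 T0 HT; set Z := gauss_mass (k / 2).
have Z0 : 0 < Z by rewrite gauss_mass_gt0// divr_gt0.
have dR : 0 < d%:R :> R by rewrite ltr0n.
have kd0 : 0 < (k * d%:R)^-1 by rewrite invr_gt0 mulr_gt0.
(* [Z / 2] keeps the interval mass below [1/2]; [rho <= 1] gives [rho^2 <= rho], and then the last
   term gives [k rho^2 d <= 1]. *)
pose rho := Num.min (Z / 2) (Num.min 1 (k * d%:R)^-1).
have rho0 : 0 < rho by rewrite !lt_min ltr01 kd0 divr_gt0.
have rho1 : rho <= 1 by rewrite /rho !ge_min lexx !orbT.
have rhoZ : rho <= Z / 2 by rewrite /rho ge_min lexx.
have rhok : rho <= (k * d%:R)^-1 by rewrite /rho !ge_min lexx !orbT.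
apply: (@relaxation_time_large_step d k h rho) => //.
  by rewrite ler_pdivrMr// mulrC mulrA mulr1.
have rho2 : rho ^+ 2 <= (k * d%:R)^-1.
  by apply: (le_trans _ rhok); rewrite expr2 ler_piMr// ltW.
have kd : 0 < k * d%:R by rewrite mulr_gt0.
by rewrite mulrAC mulrC -ler_pdivlMr// div1r.
Qed.

(** * Numerical estimates and the choice of constants *)

(** With [2500 = 50^2], [ln d = 2 ln (sqrt d) < 2 sqrt d] and [sqrt d >= 50] give the second
    bound. *)
Lemma ln_nat_bounds (d : nat) : (2500 <= d)%N ->
  1 <= ln d%:R :> R /\ 25 * ln d%:R <= d%:R :> R.
Proof.
move=> hd; have hdR : 2500 <= d%:R :> R by rewrite (ler_nat _ 2500).
have d0 : 0 < d%:R :> R by lra.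
have s0 : 0 < Num.sqrt d%:R :> R by rewrite sqrtr_gt0.
have s2 : Num.sqrt d%:R ^+ 2 = d%:R :> R by rewrite sqr_sqrtr// ltW.
have s50 : 50 <= Num.sqrt d%:R :> R.
  have -> : 50 = Num.sqrt (50 ^+ 2) :> R by rewrite sqrtr_sqr ger0_norm.
  by rewrite ler_wsqrtr//; lra.
split.
  rewrite -[leLHS]expRK ler_ln ?posrE ?expR_gt0//.
  have := expR_ge1Dx (- (1 / 2) : R); rewrite expRN.
  (* From [exp(-1/2) >= 1/2] comes [e <= 2], hence [exp 1 <= 4]. *)
  set e := expR (1 / 2); have e0 : 0 < e by exact: expR_gt0.
  have -> : expR 1 = e ^+ 2 :> R by rewrite -expRM_natl; congr expR; lra.
  move=> H; have : e * (1 - 1 / 2) <= 1.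
    by rewrite -[leRHS](@mulfV _ e) ?gt_eqF// ler_pM2l.
  by nra.
have -> : ln d%:R = 2 * ln (Num.sqrt d%:R) :> R.
  by rewrite -[in LHS]s2 lnXn// mulr_natl.
have := ln_sublinear s0; nra.
Qed.

Lemma qform_scalar d (k : R) (v : 'rV[R]_d) : qform k%:M v = k * sqnorm v.
Proof.
rewrite /qform mul_mx_scalar -scalemxAl !mxE; congr (_ * _).
by apply: eq_bigr => i _; rewrite mxE expr2.
Qed.

Lemma quad_spec d (k kappa : R) : 1 <= k -> k <= kappa ->
  exists (A : 'M[R]_d) (b : 'rV[R]_d) (c0 : R),
    A^T = A /\
    (forall x, quad k x = qform A x / 2 + (x *m b^T) 0 0 + c0) /\
    (forall v, qform 1%:M v <= qform A v <= kappa * qform 1%:M v).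
Proof.
move=> k1 kk; exists k%:M, 0, 0; split; first exact: tr_scalar_mx.
split=> [x|v].
  by rewrite trmx0 mulmx0 mxE !addr0 qform_scalar /quad mulrAC.
have v0 : 0 <= sqnorm v by apply: sumr_ge0 => i _; exact: sqr_ge0.
by rewrite !qform_scalar mul1r ler_peMl//= ler_wpM2r.
Qed.

(** With [t = 25 ln d / d <= 1], one has [1 + u^2 >= 1 + t >= exp(t/2)]. Hence the square of the
    left side is at most [exp(-d t / 2) = d^(-25/2)], below [d^(-10)]. *)
Lemma contraction_pow_le d (u : R) : (2500 <= d)%N -> 25 * ln d%:R <= u ^+ 2 * d%:R ->
  (Num.sqrt (1 + u ^+ 2))^-1 ^+ d <= (d%:R ^+ 5)^-1.
Proof.
move=> hd; have [L1 Ld] := ln_nat_bounds hd.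
have dR0 : 0 < d%:R :> R by rewrite ltr0n (leq_trans _ hd).
set L := ln d%:R in L1 Ld * => Lu.
pose t : R := 25 * L / d%:R.
have t0 : 0 <= t by rewrite divr_ge0//; lra.
have t1 : t <= 1 by rewrite ler_pdivrMr// mul1r.
have tu : t <= u ^+ 2 by rewrite ler_pdivrMr.
set r := (Num.sqrt (1 + u ^+ 2))^-1.
have r0 : 0 <= r by rewrite invr_ge0 sqrtr_ge0.
have u0 : 0 < 1 + u ^+ 2 by rewrite ltr_pwDl// sqr_ge0.
have r2 : r ^+ 2 <= expR (- (t / 2)).
  rewrite exprVn sqr_sqrtr; last exact: ltW.
  rewrite expRN lef_pV2 ?posrE ?expR_gt0//.
  set e := expR (t / 2); have e0 : 0 < e by exact: expR_gt0.
  have E : e * (1 - t / 2) <= 1.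
    rewrite -[leRHS](@mulfV _ e) ?gt_eqF//.
    by rewrite ler_pM2l// -expRN; exact: expR_ge1Dx.
  (* [exp(t/2) <= 1 / (1 - t/2) <= 1 + t], the last step using [t <= 1]. *)
  apply: (@le_trans _ _ (1 + t)); last by rewrite lerD2l.
  have t2 : 0 < 1 - t / 2 by lra.
  rewrite -(ler_pM2r t2); apply: (le_trans E).
  by rewrite -subr_ge0 (_ : _ - _ = t * (1 - t) / 2);
    [rewrite divr_ge0// mulr_ge0// subr_ge0|field].
rewrite -(@ler_pXn2r _ 2)// ?nnegrE ?exprn_ge0 ?invr_ge0 ?exprn_ge0 ?(ltW dR0)//.
rewrite exprAC; apply: (@le_trans _ _ (expR (- (t / 2)) ^+ d)).
  by apply: lerXn2r; rewrite ?nnegrE ?expR_ge0 ?sqr_ge0.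
rewrite -expRM_natl exprVn -exprM -[X in (X ^+ _)^-1]lnK ?posrE//.
rewrite -expRM_natl -expRN ler_expR -/L.
rewrite (_ : d%:R * - (t / 2) = - (25 / 2 * L)); last first.
  by rewrite /t; field; rewrite gt_eqF.
by rewrite lerN2 ler_wpM2r//; lra.
Qed.

Theorem theorem1 :
  exists (c : R) (d0 : nat), 0 < c /\
  forall (d : nat) (kappa h : R),
    (d0 <= d)%N -> 10 <= kappa -> kappa <= d%:R ^+ 4 -> 0 < h ->
    exists f : 'rV[R]_d -> R,
      (exists (A : 'M[R]_d) (b : 'rV[R]_d) (c0 : R),
         A^T = A /\
         (forall x, f x = qform A x / 2 + (x *m b^T) 0 0 + c0) /\
         (forall v, qform 1%:M v <= qform A v <= kappa * qform 1%:M v)) /\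
      ((c * kappa * Num.sqrt d%:R / Num.sqrt (ln d%:R))%:E
         <= relaxation_time f h)%E.
Proof.
pose v0 : R := (gauss_mass (1 / 2))^-1 * expR (- 2).
have v0_gt0 : 0 < v0.
  by rewrite mulr_gt0 ?expR_gt0// invr_gt0 gauss_mass_gt0// divr_gt0.
(* The large-step case uses [1/4]; the small-step case needs [18 * 5 * c <= v0], where 5 is the
   threshold constant. *)
pose c : R := Num.min (1 / 4) (v0 / 90).
have c0 : 0 < c by rewrite lt_min !divr_gt0.
have c4 : c <= 1 / 4 by rewrite /c ge_min lexx.
have cv : c * 90 <= v0 by rewrite -ler_pdivlMr// /c ge_min lexx orbT.
clearbody c.
exists c, 2500%N; split => // d kappa h hd k10 kd h0.
have [L1 Ld] := ln_nat_bounds hd.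
have rate := contraction_pow_le hd.
have dR : 2500 <= d%:R :> R by rewrite (ler_nat _ 2500).
have d0 : (0 < d)%N by apply: leq_trans hd.
set L := ln d%:R in L1 Ld rate *; clearbody L.
set S := Num.sqrt d%:R; set M := Num.sqrt L.
have S2 : S ^+ 2 = d%:R by rewrite sqr_sqrtr//; lra.
have M2 : M ^+ 2 = L by rewrite sqr_sqrtr//; lra.
have S0 : 0 < S by rewrite sqrtr_gt0; lra.
have M0 : 0 < M by rewrite sqrtr_gt0; lra.
have M1 : 1 <= M by rewrite -[leLHS]sqrtr1 ler_wsqrtr.
have MS : 5 * M <= S.
  have -> : 5 * M = Num.sqrt (5 ^+ 2 * L).
    by rewrite sqrtrM ?sqr_ge0// sqrtr_sqr ger0_norm.
  by rewrite ler_wsqrtr// (_ : 5 ^+ 2 = 25)//; ring.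
have k0 : 0 < kappa by lra.
have T0 : 0 < c * kappa * S / M by rewrite divr_gt0// !mulr_gt0.
clearbody S M.
case: (leP (h * kappa * S) (5 * M)) => [small|large].
  exists (@quad d 1); split; first by apply: quad_spec; lra.
  have [n dn] : exists n, d = n.+1 by exists d.-1; rewrite prednK.
  have hT : 18 * h * (c * kappa * S / M) <= v0.
    rewrite (_ : 18 * h * _ = 18 * (c * (h * kappa * S / M))).
      have : h * kappa * S / M <= 5 by rewrite ler_pdivrMr.
      by move=> /(ler_wpM2l (ltW c0)); lra.
    by field; rewrite gt_eqF.
  have h1 : h <= 1.
    have : h * kappa * S <= 1 * S by rewrite mul1r (le_trans small).
    rewrite ler_pM2r// => hk1.
    have : h * 10 <= h * kappa by rewrite ler_pM2l.
    by lra.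
  by rewrite dn; exact: relaxation_time_small_step.
exists (@quad d kappa); split; first by apply: quad_spec; lra.
apply: relaxation_time_curved => //.
have {}rate : (Num.sqrt (1 + (h * kappa) ^+ 2))^-1 ^+ d <= (d%:R ^+ 5)^-1.
  apply: rate; rewrite -S2 -M2 -exprMn (_ : 25 * M ^+ 2 = (5 * M) ^+ 2); last by ring.
  by apply: lerXn2r; rewrite ?nnegrE ?mulr_ge0 ?ltW// !mulr_gt0.
have dR0 : 0 < d%:R :> R by lra.
have S1 : S <= d%:R by rewrite -S2 expr2 ler_peMl; lra.
(* The hypothesis [kappa <= d^4] enters here: with [S <= d] and [M >= 1] the target time is at most
   [d^5 / 4], matching the rate [d^(-5)]. *)
have Td : c * kappa * S / M <= 1 / 4 * d%:R ^+ 5.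
  rewrite ler_pdivrMr//; apply: (@le_trans _ _ (1 / 4 * d%:R ^+ 5)).
    rewrite exprSr mulrA; apply: ler_pM => //; try exact: ltW.
      by rewrite mulr_ge0 ?ltW.
    by apply: ler_pM => //; exact: ltW.
  by rewrite ler_peMr// mulr_ge0// exprn_ge0// ltW.
apply: (@le_trans _ _ ((d%:R ^+ 5)^-1 * (1 / 4 * d%:R ^+ 5))).
  by apply: ler_pM => //; exact: ltW.
by rewrite mulrCA mulVf ?mulr1// expf_neq0// gt_eqF.
Qed.
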